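(* Let $n\ge 2$ and let \[ T = \begin{pmatrix} 0&0&0&0&1&1&1&1&1&0&0 \\ 0&0&0&0&1&1&1&1&1&1&0 \\ 0&0&0&0&1&1&1&1&0&0&0 \\ 0&0&0&0&1&1&1&1&0&1&0 \\ 1&1&1&1&0&0&0&0&1&0&0 \\ 1&1&1&1&0&0&0&0&1&1&0 \\ 1&1&1&1&0&0&0&0&0&1&0 \\ 1&1&1&1&0&0&0&0&0&0&0 \\ 1&1&0&0&1&1&0&0&0&1&0 \\ 0&1&0&1&0&1&0&1&1&0&0 \\ 0&0&0&0&0&0&0&0&0&0&0 \end{pmatrix}. \] If there exists a simple minimiser in $\mathcal{S}_n$, then there exist non-negative integers $x_1,\dots,x_{11}$ with $x_1+\dots+x_{11}=n$ such that the vertex multiplication $\tilde{T}$ of $T$ by $[x_1,\dots,x_{11}]$ satisfies \[ \lambda_{n-1}(\tilde{T}) - 2\sqrt{n} \le \lambda_{n-1}(S) \quad\text{for all } S \in \mathcal{S}_n. \]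
   Context: $\mathcal{S}_n$ is the set of $n\times n$ real symmetric matrices with all entries in $[0,1]$; $\lambda_k(M)$ is the $k$-th largest eigenvalue of $M$ counted with multiplicity. A simple minimiser is a matrix $M\in\mathcal{S}_n$ with $\lambda_n(M) < \lambda_{n-1}(M)$ such that $\lambda_{n-1}(M)\le\lambda_{n-1}(M')$ for all $M'\in\mathcal{S}_n$. For a $k\times k$ symmetric $0/1$ matrix $T$ with zero diagonal and non-negative integers $x_1,\dots,x_k$, the vertex multiplication of $T$ by $[x_1,\dots,x_k]$ is the $(\sum_i x_i)\times(\sum_i x_i)$ block matrix whose $(i,j)$ block is the $x_i\times x_j$ matrix with every entry equal to $T_{ij}$ (equivalently, the adjacency matrix of the graph obtained from the graph of $T$ by replacing vertex $i$ with an independent set of $x_i$ vertices and each edge $ij$ by a complete bipartite graph between the corresponding sets). *)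

(* Defs.v *)
From HB Require Import structures.
From mathcomp Require Import all_boot all_order all_algebra.
From mathcomp Require Import polyrcf.
From mathcomp Require Import reals.
Set Implicit Arguments. Unset Strict Implicit. Unset Printing Implicit Defensive.
Import Order.TTheory GRing.Theory Num.Theory.
Local Open Scope ring_scope.

Section Defs.
Variable R : realType.

Definition eigs {n : nat} (M : 'M[R]_n) : seq R :=
  let p := char_poly M in
  sort (fun a b : R => b <= a)
       (flatten [seq nseq (mup x p) x | x <- rootsR p]).

Definition lambda {n : nat} (k : nat) (M : 'M[R]_n) : R := nth 0 (eigs M) k.-1.

Definition inS {n : nat} (M : 'M[R]_n) : Prop :=
  M^T = M /\ forall i j, 0 <= M i j <= 1.

Definition simple_minimiser {n : nat} (M : 'M[R]_n) : Prop :=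
  inS M /\ lambda n M < lambda n.-1 M /\
  forall M' : 'M[R]_n, inS M' -> lambda n.-1 M <= lambda n.-1 M'.

(* vertex multiplication of T : 'M_k by xs = [x_1;...;x_k]: vertex i of the
   result (0 <= i < sum xs) lies in block j (0-based), the least j with
   i < x_1 + ... + x_(j+1). *)
Definition block (xs : seq nat) (i : nat) : nat :=
  find (fun j => i < \sum_(l < j.+1) nth 0 xs l)%N (iota 0 (size xs)).

Definition vmult {k : nat} (T : 'M[R]_k.+1) (xs : seq nat) (n : nat) : 'M[R]_n :=
  \matrix_(i < n, j < n) T (inord (block xs i)) (inord (block xs j)).

Definition Tlist : seq (seq nat) :=
  [:: [:: 0;0;0;0;1;1;1;1;1;0;0];
      [:: 0;0;0;0;1;1;1;1;1;1;0];
      [:: 0;0;0;0;1;1;1;1;0;0;0];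
      [:: 0;0;0;0;1;1;1;1;0;1;0];
      [:: 1;1;1;1;0;0;0;0;1;0;0];
      [:: 1;1;1;1;0;0;0;0;1;1;0];
      [:: 1;1;1;1;0;0;0;0;0;1;0];
      [:: 1;1;1;1;0;0;0;0;0;0;0];
      [:: 1;1;0;0;1;1;0;0;0;1;0];
      [:: 0;1;0;1;0;1;0;1;1;0;0];
      [:: 0;0;0;0;0;0;0;0;0;0;0]]%N.

Definition Tmx : 'M[R]_11 := \matrix_(i < 11, j < 11) (nth 0%N (nth [::] Tlist i) j)%:R.

End Defs.

(* Main.v *)
Require Import Defs.
From HB Require Import structures.
From mathcomp Require Import all_boot all_order all_algebra.
From mathcomp Require Import polyrcf.
From mathcomp Require Import reals.
From mathcomp Require Import perm complex ring lra zify.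
Set Implicit Arguments. Unset Strict Implicit. Unset Printing Implicit Defensive.
Import Order.TTheory GRing.Theory Num.Theory.
Local Open Scope ring_scope.

(* A simple minimiser [M] satisfies [lambda_{n-1}(M) > -n/3]; the vertex
   multiplication of T by a complete tripartite choice of sizes [a, a, n-2a] on
   the triangle formed by rows 1, 5, 9, with a = floor(n/3), has
   [lambda_{n-1} <= -a], so it is within [2 sqrt n] of the optimum.

   For the first claim let [v] be an eigenvector for [lambda_{n-1}(M) = -r].
   Since [lambda_n(M)] is simple, first-order optimality forces M to be 0 where
   [v_i v_j > 0] and 1 where [v_i v_j < 0].  With P, N, Z the sets where [v] is
   positive, negative, zero, the equation [M v = -r v] makes [v] constant on P
   and on N, gives [|P| = r k] and [|N| = r / k], and makes every row indexed
   by Z balanced: its sum over P is [k] times its sum over N.  If [r >= n/3]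
   then [|Z| <= n - 2r <= r], and this suffices for [y^T M y + r |y|^2 >= 0]
   on the orthogonal complement of [v], contradicting
   [lambda_n(M) < lambda_{n-1}(M)].

   Rows 7, 8 and 10 of T are not mutually symmetric; the chosen sizes vanish
   there. *)

(** * Spectral theorem for real symmetric matrices *)

(** Over the algebraically closed [R[i]] there is some eigenvalue [mu]. Pairing its eigenvector [v]
    with the conjugate of [v] through the real symmetric matrix in two ways shows that [mu] equals
    its conjugate, so [mu] is already a root over [R]. *)
Lemma sym_eigenvalue_exists (R : rcfType) n (A : 'M[R]_n.+1) :
  A^T = A -> exists a, eigenvalue A a.
Proof.
move=> symA; pose AC := map_mx (real_complex R) A.
have symAC : AC^T = AC by rewrite /AC -[in RHS]symA; apply/matrixP => i j; rewrite !mxE.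
have [mu] : exists mu, root (char_poly AC) mu.
  by apply/closed_rootP; rewrite size_char_poly.
rewrite -eigenvalue_root_char => /eigenvalueP[v vA v0].
pose vc := map_mx (@conjc R) v.
have vcA : vc *m AC = (mu^*)%C *: vc.
  have := congr1 (map_mx (@conjc R)) vA.
  rewrite map_mxM map_mxZ => <-; congr (_ *m _).
  by apply/matrixP => i j; rewrite /AC !mxE /= oppr0.
have E1 : (v *m AC *m vc^T) 0 0 = mu * (v *m vc^T) 0 0.
  by rewrite vA -scalemxAl mxE.
have E2 : (v *m AC *m vc^T) 0 0 = (mu^*)%C * (v *m vc^T) 0 0.
  rewrite -mulmxA -{1}symAC -trmx_mul vcA.
  by rewrite linearZ /= -scalemxAr mxE.
have nz : (v *m vc^T) 0 0 != 0.
  rewrite !mxE psumr_neq0; last by move=> i _; rewrite !mxE; exact: mul_conjC_ge0.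
  case/rV0Pn: v0 => j vj; apply/hasP; exists j; first exact: mem_index_enum.
  by rewrite !mxE /=; have := mul_conjC_gt0 (v 0 j); rewrite vj.
have/(mulIf nz) mur : mu * (v *m vc^T) 0 0 = (mu^*)%C * (v *m vc^T) 0 0.
  by rewrite -E1 E2.
have [a mua] : exists a : R, mu = real_complex R a.
  exists (complex.Re mu); apply/eqP; rewrite eq_complex /= eqxx /=.
  have /eqP := mur; case: (mu) => x y /=; rewrite eq_complex /= => /andP[_].
  by rewrite -subr_eq0 opprK -mulr2n mulrn_eq0.
exists a; rewrite eigenvalue_root_char -(fmorph_root (real_complex R)).
rewrite map_char_poly -eigenvalue_root_char.
by apply/eigenvalueP; exists v => //; rewrite vA mua.
Qed.

(* The Householder reflection exchanging [e] and the first basis vector. *)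
Lemma orthogonal_with_first_row (R : rcfType) n (e : 'rV[R]_n.+1) :
  e *m e^T = 1%:M -> exists2 H : 'M[R]_n.+1, H *m H^T = 1%:M & row 0 H = e.
Proof.
move=> ee; pose d : 'rV[R]_n.+1 := delta_mx 0 0; pose h := e - d.
have [h0|hN0] := eqVneq h 0.
  exists 1%:M; first by rewrite trmx1 mulmx1.
  by move/eqP: h0; rewrite subr_eq0 => /eqP ->; rewrite row1.
pose c := (h *m h^T) 0 0.
have hh : h *m h^T = c%:M by rewrite [LHS]mx11_scalar.
have cN0 : c != 0.
  rewrite /c !mxE psumr_neq0; last by move=> i _; rewrite !mxE -expr2 sqr_ge0.
  case/rV0Pn: hN0 => j hj; apply/hasP; exists j; first exact: mem_index_enum.
  by rewrite [h^T _ _]mxE -expr2 exprn_even_gt0.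
have dd : (d *m d^T) 0 0 = 1 by rewrite /d trmx_delta mul_delta_mx mxE !eqxx.
have de : (d *m e^T) 0 0 = e 0 0.
  by rewrite /d -rowE !mxE.
have ed : (e *m d^T) 0 0 = e 0 0.
  by rewrite -[e *m d^T]trmxK trmx_mul trmxK mxE de.
have cE : c = 2 * (1 - e 0 0).
  rewrite /c /h linearB /= mulmxBl !mulmxBr.
  have sub4 (A B C D : 'M[R]_1) :
    (A - B - (C - D)) 0 0 = A 0 0 - B 0 0 - (C 0 0 - D 0 0) by rewrite !mxE.
  by rewrite sub4 ee dd de ed mxE eqxx mulr1n; ring.
have dh : d *m h^T = (- (c / 2))%:M.
  rewrite [LHS]mx11_scalar /h linearB /= mulmxBr; congr (_%:M).
  have sub2 (A B : 'M[R]_1) : (A - B) 0 0 = A 0 0 - B 0 0 by rewrite !mxE.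
  by rewrite sub2 dd de cE; field.
have eE : e = d + h by rewrite /h addrC subrK.
have dE : d = delta_mx 0 0 by [].
clearbody c h d.
(* The reflection in the hyperplane orthogonal to [h] is a symmetric involution, hence orthogonal.
   Since [d *m h^T] is [- (c / 2)], it sends [d] to [d + h], which is [e]. *)
exists (1%:M - (2 / c) *: (h^T *m h)).
  have -> : (1%:M - (2 / c) *: (h^T *m h))^T = 1%:M - (2 / c) *: (h^T *m h).
    by rewrite linearB linearZ /= trmx_mul trmxK trmx1.
  rewrite mulmxBl mul1mx mulmxBr mulmx1 -scalemxAl -scalemxAr scalerA.
  rewrite -mulmxA (mulmxA h) hh mul_scalar_mx -scalemxAr scalerA.
  move: (h^T *m h) => K; apply/matrixP => i j; rewrite !mxE.
  by move: (_ *+ _) => x; field.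
rewrite rowE -dE mulmxBr mulmx1 -scalemxAr mulmxA dh mul_scalar_mx scalerA.
have -> : 2 / c * - (c / 2) = -1 by field; rewrite cN0.
by rewrite scaleN1r opprK eE.
Qed.

Lemma char_poly_orthogonal (R : comNzRingType) n (Q A : 'M[R]_n) :
  Q *m Q^T = 1%:M -> char_poly (Q *m A *m Q^T) = char_poly A.
Proof.
move=> QQ; rewrite /char_poly.
have QQP : map_mx polyC Q *m map_mx polyC Q^T = 1%:M.
  by rewrite -map_mxM QQ map_mx1.
have -> : char_poly_mx (Q *m A *m Q^T) =
    map_mx polyC Q *m char_poly_mx A *m map_mx polyC Q^T.
  rewrite /char_poly_mx !map_mxM mulmxBr mulmxBl; congr (_ - _).
  by rewrite scalar_mxC -mulmxA QQP mulmx1.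
by rewrite !det_mulmx mulrAC -det_mulmx QQP det1 mul1r.
Qed.

(** Deflation: an orthogonal change of basis makes a unit eigenvector the first basis vector.
    Symmetry then clears the first row and column off the diagonal, and induction applies to the
    remaining block. *)
Lemma sym_spectral (R : rcfType) n (A : 'M[R]_n) :
  A^T = A -> exists Q : 'M[R]_n, exists d : 'rV[R]_n,
    Q *m Q^T = 1%:M /\ Q *m A *m Q^T = diag_mx d.
Proof.
elim: n A => [|n IHn] A symA.
  by exists 1%:M, 0; split; apply/matrixP => -[].
have [a /eigenvalueP[v vA v0]] := sym_eigenvalue_exists symA.
pose c := (v *m v^T) 0 0.
have c0 : 0 < c.
  rewrite /c !mxE; have sq0 i : 0 <= v 0 i * v^T i 0.
    by rewrite [v^T _ _]mxE -expr2 sqr_ge0.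
  rewrite lt_def sumr_ge0 // andbT psumr_neq0 //.
  case/rV0Pn: v0 => j hj; apply/hasP; exists j; first exact: mem_index_enum.
  by rewrite [v^T _ _]mxE -expr2 exprn_even_gt0.
pose e := (Num.sqrt c)^-1 *: v.
have ee : e *m e^T = 1%:M.
  rewrite /e linearZ /= -scalemxAl -scalemxAr scalerA -invfM -expr2.
  rewrite sqr_sqrtr ?ltW // [v *m _]mx11_scalar -/c scale_scalar_mx mulVf //.
  by rewrite gt_eqF.
have eA : e *m A = a *: e by rewrite -scalemxAl vA !scalerA mulrC.
have [H HH rowH] := orthogonal_with_first_row ee.
pose B : 'M[R]_(1 + n) := H *m A *m H^T.
have symB : B^T = B by rewrite /B !trmx_mul trmxK symA mulmxA.
have rowB : row 0 B = a *: row 0 (1%:M : 'M[R]_n.+1).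
  rewrite /B -HH !row_mul rowH eA.
  by rewrite -scalemxAl.
have BE : H *m A *m H^T = B by [].
clearbody B.
have rowBE j : B 0 j = a * (0 == j)%:R.
  by have := congr1 (fun r : 'rV[R]_(1 + n) => r 0 j) rowB; rewrite !mxE.
have lshift0 : lshift n 0 = 0 :> 'I_(1 + n) by apply/val_inj.
have urB : ursubmx B = 0.
  apply/matrixP => i j; rewrite ord1 !mxE lshift0 rowBE.
  by rewrite (_ : (0 == _) = false) ?mulr0.
have ulB : ulsubmx B = a%:M.
  apply/matrixP => i j; rewrite !ord1 !mxE lshift0 rowBE.
  by rewrite eqxx mulr1.
have dlB : dlsubmx B = 0.
  by rewrite -[dlsubmx B]trmxK -symB trmx_dlsub trmxK urB trmx0.
have [|Q' [d' [QQ' QAQ']]] := IHn (drsubmx B).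
  by rewrite -[in RHS]symB trmx_drsub.
pose K : 'M[R]_(1 + n) := block_mx 1%:M 0 0 Q'.
have KT : K^T = block_mx 1%:M 0 0 Q'^T.
  by rewrite /K (tr_block_mx 1%:M) trmx1 !trmx0.
have KK : K *m K^T = 1%:M.
  rewrite KT /K (mulmx_block 1%:M) !mul0mx !mulmx0 mulmx1 addr0 !add0r QQ'.
  by rewrite -scalar_mx_block.
exists (K *m H), (row_mx a%:M d'); split.
  by rewrite trmx_mul mulmxA -(mulmxA K) HH mulmx1.
rewrite trmx_mul mulmxA -(mulmxA K) -(mulmxA K) BE KT -[B]submxK ulB urB dlB.
rewrite /K !(@mulmx_block _ 1 n 1 n 1 n).
rewrite !mul0mx !mulmx0 !mulmx1 !mul1mx !addr0 !add0r !mul0mx QAQ'.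
rewrite [RHS](diag_mx_row a%:M d').
congr (@block_mx _ 1 n 1 n _ _ _ _).
by apply/matrixP => i j; rewrite !ord1 !mxE.
Qed.

(** * The sorted list [eigs] as the diagonal of an orthogonal diagonalisation *)

(** [rootsR] has no repetitions, so each root is emitted by exactly one block, whose length is its
    multiplicity in [s]. *)
Lemma perm_mup_roots (R : rcfType) (s : seq R) :
  perm_eq (flatten [seq nseq (mup x (\prod_(y <- s) ('X - y%:P))) x
                   | x <- rootsR (\prod_(y <- s) ('X - y%:P))]) s.
Proof.
set p := \prod_(y <- s) _.
have p0 : p != 0 by rewrite monic_neq0 // monic_prod_XsubC.
have mem_rootsR x : (x \in rootsR p) = (x \in s).
  by have := roots_on_rootsR p0 x; rewrite root_prod_XsubC => <-.
apply/allP => x _; apply/eqP; rewrite count_flatten -map_comp.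
rewrite sumnE big_map (eq_bigr (fun y => if y == x then count_mem x s else 0%N)).
  rewrite -big_mkcond /= big_const_seq iter_addn_0.
  have [xs|xs] := boolP (x \in s).
    rewrite (count_uniq_mem _ (uniq_roots _ _ _)) -/(rootsR p) mem_rootsR xs.
    by rewrite muln1.
  by rewrite (count_memPn xs).
move=> y _ /=; rewrite count_nseq mu_prod_XsubC /=.
by case: eqVneq => [->|_]; rewrite ?mul1n ?mul0n.
Qed.

Lemma char_poly_diag (R : comNzRingType) n (d : 'rV[R]_n) :
  char_poly (diag_mx d) = \prod_(y <- [tuple d 0 i | i < n]) ('X - y%:P).
Proof.
rewrite char_poly_trig ?diag_mx_is_trig // big_map val_ord_tuple big_enum /=.
by apply: eq_bigr => i _; rewrite mxE eqxx.
Qed.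

(** The diagonal obtained from [sym_spectral] is a permutation of [eigs A]; permuting the rows of
    the orthogonal matrix accordingly sorts it. *)
Lemma spectral_eigs (R : realType) n (A : 'M[R]_n) : A^T = A ->
  size (eigs A) = n /\ exists2 Q : 'M[R]_n, Q *m Q^T = 1%:M &
    Q *m A *m Q^T = diag_mx (\row_i (eigs A)`_i).
Proof.
move=> symA; have [Q [d [QQ QAQ]]] := sym_spectral symA.
have /tuple_permP[s eigsE] : perm_eq (eigs A) [tuple d 0 i | i < n].
  rewrite /eigs perm_sort -(char_poly_orthogonal A QQ) QAQ char_poly_diag.
  exact: perm_mup_roots.
split; first by rewrite eigsE size_tuple.
have QsE i j : row_perm s Q i j = Q (s i) j by rewrite mxE.
exists (row_perm s Q).
  rewrite row_permE trmx_mul mulmxA -(mulmxA _ Q) QQ mulmx1.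
  by rewrite tr_perm_mx -perm_mxM mulgV perm_mx1.
have -> : row_perm s Q *m A *m (row_perm s Q)^T =
    \matrix_(i, j) (Q *m A *m Q^T) (s i) (s j).
  apply/matrixP => i j; rewrite !mxE; apply: eq_bigr => k _; rewrite !mxE.
  by congr (_ * _); apply: eq_bigr => l _; rewrite !mxE.
apply/matrixP => i j; rewrite QAQ !mxE (inj_eq perm_inj) eigsE.
by rewrite -tnth_nth !tnth_mktuple.
Qed.

(** * Quadratic forms with balanced rows *)

(** Linearised Cauchy-Schwarz: expand the sum of the squares of [f i - c]. It is sharpest when [c]
    is the mean of [f] on [A]. *)
Lemma sum_sqr_tangent (R : realFieldType) (I : finType) (A : {set I})
    (f : I -> R) (c : R) :
  2 * c * \sum_(i in A) f i - c ^+ 2 * #|A|%:R <= \sum_(i in A) f i ^+ 2.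
Proof.
rewrite mulr_natr -sumr_const mulr_sumr -sumrB; apply: ler_sum => i _.
by rewrite -subr_ge0; have := sqr_ge0 (f i - c); congr (_ <= _); ring.
Qed.

Lemma sum_setC2 (R : nmodType) (I : finType) (P N : {set I}) (F : I -> R) :
  [disjoint P & N] ->
  \sum_i F i = \sum_(i in P) F i + \sum_(i in N) F i
               + \sum_(i in ~: (P :|: N)) F i.
Proof.
move=> PN; rewrite (bigID (mem P)) -addrA [X in _ + X = _](bigID (mem N)) /=.
congr (_ + (_ + _)); apply: eq_bigl => i; last by rewrite !inE negb_or.
by have [/(disjointFl PN) ->|] := boolP (i \in N); rewrite ?andbF.
Qed.

Section BalancedForm.
Variables (R : realFieldType) (I : finType) (M : I -> I -> R).
Variables (P N : {set I}) (r k : R).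
Let Z := ~: (P :|: N).
Hypotheses (symM : forall i j, M i j = M j i).
Hypotheses (M01 : forall i j, 0 <= M i j <= 1).
Hypotheses (disjPN : [disjoint P & N]).
Hypotheses (MPP : {in P &, forall i j, M i j = 0}).
Hypotheses (MNN : {in N &, forall i j, M i j = 0}).
Hypotheses (MPN : {in P & N, forall i j, M i j = 1}).
Hypotheses (r_gt0 : 0 < r) (k_ge1 : 1 <= k).
Hypotheses (cardP : #|P|%:R = r * k) (cardN : #|N|%:R = r / k).
Hypotheses (cardZ : #|Z|%:R <= r).
Hypotheses (balM : {in Z, forall i,
  \sum_(j in P) M i j = k * \sum_(j in N) M i j}).

Let wgt (f : I -> R) j := \sum_(i in Z) M i j * f i.

Lemma wgt_ge0 f j : (forall i, 0 <= f i) -> 0 <= wgt f j.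
Proof.
by move=> f0; apply: sumr_ge0 => i _; rewrite mulr_ge0 //; case/andP: (M01 i j).
Qed.

Lemma wgt_le f j : (forall i, 0 <= f i) -> wgt f j <= \sum_(i in Z) f i.
Proof.
move=> f0; apply: ler_sum => i _.
by rewrite ler_piMl //; case/andP: (M01 i j).
Qed.

Lemma wgt_balanced f : \sum_(j in P) wgt f j = k * \sum_(j in N) wgt f j.
Proof.
rewrite /wgt exchange_big [in RHS]exchange_big mulr_sumr /=.
by apply: eq_bigr => i iZ; rewrite -!mulr_suml balM // mulrA.
Qed.

(** To be applied to the positive and negative parts of a vector. The weights of [f] and [g] lie in
    [[0, A]] and [[0, B]], so their squares are bounded linearly, and the sums over [P] and [N]
    depend only on the means [xi] and [eta] over [N]. *)
Lemma wgt_sqr_bound (f g : I -> R) :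
  (forall i, 0 <= f i) -> (forall i, 0 <= g i) ->
  let A := \sum_(i in Z) f i in let B := \sum_(i in Z) g i in
  let X := (\sum_(j in N) wgt f j - \sum_(j in N) wgt g j) * k / r in
  \sum_(j in P) (wgt f j - wgt g j) ^+ 2 +
  \sum_(j in N) (wgt f j - wgt g j) ^+ 2 <=
    r / k * X ^+ 2 + r * (A ^+ 2 + B ^+ 2).
Proof.
move=> f0 g0 /=; set A := \sum_(i in Z) f i; set B := \sum_(i in Z) g i.
set X := (_ - _) * k / r.
have k_gt0 : 0 < k by apply: lt_le_trans k_ge1.
pose q := r / k; have q_gt0 : 0 < q by rewrite divr_gt0.
pose xi := (\sum_(j in N) wgt f j) / q; pose eta := (\sum_(j in N) wgt g j) / q.
have NE : \sum_(j in N) wgt f j = q * xi by rewrite /xi mulrC divfK ?gt_eqF.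
have NE' : \sum_(j in N) wgt g j = q * eta by rewrite /eta mulrC divfK ?gt_eqF.
have rE : r = k * q by rewrite /q mulrC divfK ?gt_eqF.
have PE : \sum_(j in P) wgt f j = r * xi by rewrite wgt_balanced NE rE mulrA.
have PE' : \sum_(j in P) wgt g j = r * eta by rewrite wgt_balanced NE' rE mulrA.
have XE : X = xi - eta by rewrite /X NE NE' /q; field; rewrite !gt_eqF.
have A0 : 0 <= A by apply: sumr_ge0.
have B0 : 0 <= B by apply: sumr_ge0.
have xiA : xi <= A.
  rewrite /xi ler_pdivrMr // /q -cardN mulr_natr -sumr_const.
  by apply: ler_sum => j _; apply: wgt_le.
have etaB : eta <= B.
  rewrite /eta ler_pdivrMr // /q -cardN mulr_natr -sumr_const.
  by apply: ler_sum => j _; apply: wgt_le.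
have bnd j : (wgt f j - wgt g j) ^+ 2 <= A * wgt f j + B * wgt g j.
  have := wgt_ge0 j f0; have := wgt_ge0 j g0.
  have := wgt_le j f0; have := wgt_le j g0; rewrite -/A -/B => *; nra.
(* With [p], [q] for the two weights, the slack is [p * (A - p) + q * (B - q) + 2 * (A - p) * (B -
   q)]. This improves on [bnd] when [A * B - A * q - B * p] is negative. *)
have bnd' j : (wgt f j - wgt g j) ^+ 2 <=
    A * wgt f j + B * wgt g j + 2 * (A * B - A * wgt g j - B * wgt f j).
  have := wgt_ge0 j f0; have := wgt_ge0 j g0.
  have := wgt_le j f0; have := wgt_le j g0; rewrite -/A -/B => *; nra.
have sP : \sum_(j in P) (wgt f j - wgt g j) ^+ 2 <= A * (r * xi) + B * (r * eta).
  rewrite -PE -PE' !mulr_sumr -big_split /=; apply: ler_sum => j _; exact: bnd.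
have sN : \sum_(j in N) (wgt f j - wgt g j) ^+ 2 <= A * (q * xi) + B * (q * eta).
  rewrite -NE -NE' !mulr_sumr -big_split /=; apply: ler_sum => j _; exact: bnd.
have sN' : \sum_(j in N) (wgt f j - wgt g j) ^+ 2 <=
    A * (q * xi) + B * (q * eta) + 2 * (A * B * q - A * (q * eta) - B * (q * xi)).
  rewrite -NE -NE' /q -cardN mulr_natr -sumr_const !mulr_sumr -!sumrB.
  by rewrite mulr_sumr -!big_split /=; apply: ler_sum => j _;
    rewrite -[\sum_(i in Z) A * g i]mulr_sumr; apply: bnd'.
(* AM-GM: [(A - xi)^2 + (B - eta)^2 - 2 xi eta >= 2 D]. *)
have core D : D = A * B - A * eta - B * xi ->
    (r + q) * (A * xi + B * eta) + 2 * q * Num.min 0 D <=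
    q * X ^+ 2 + r * (A ^+ 2 + B ^+ 2).
  move=> DE; have mD : Num.min 0 D <= D by rewrite ge_min lexx orbT.
  have m0 : Num.min 0 D <= 0 by rewrite ge_min lexx.
  move: (Num.min 0 D) mD m0 => m mD m0.
  rewrite XE rE -subr_ge0.
  have -> : q * (xi - eta) ^+ 2 + k * q * (A ^+ 2 + B ^+ 2) -
     ((k * q + q) * (A * xi + B * eta) + 2 * q * m) =
     q * (((A - xi) - (B - eta)) ^+ 2 + 2 * (D - m)
       + (k - 1) * (A * (A - xi) + B * (B - eta))) by rewrite DE; ring.
  apply: mulr_ge0; first exact: ltW.
  apply: addr_ge0; last first.
    apply: mulr_ge0; first by rewrite subr_ge0.
    by apply: addr_ge0; apply: mulr_ge0; rewrite ?subr_ge0.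
  by apply: addr_ge0; rewrite ?sqr_ge0 ?mulr_ge0 ?subr_ge0.
apply: le_trans (core _ erefl).
(* The sign of [D] tells which of [sN] and [sN'] is the smaller bound on [N]; [Num.min 0 D] covers
   both. *)
have [D0|D0] := leP 0 (A * B - A * eta - B * xi).
- by apply: le_trans (lerD sP sN) _; rewrite le_eqVlt; apply/orP; left; apply/eqP; ring.
- by apply: le_trans (lerD sP sN') _; rewrite le_eqVlt; apply/orP; left; apply/eqP; ring.
Qed.

(** Multiply by [r] and complete squares to [r * y i + wgt y i] on [P] and [N]. Bounding these from
    below by their means and the leftover weights by [wgt_sqr_bound] leaves
    [r / k * (2 * k * a + X) ^+ 2] plus a non-negative term coming from [Z]. *)
Lemma balanced_form_ge0 (y : I -> R) :
  \sum_(i in P) y i = k * \sum_(i in N) y i ->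
  0 <= \sum_i \sum_j M i j * y i * y j + r * \sum_i y i ^+ 2.
Proof.
move=> baly.
have k_gt0 : 0 < k by apply: lt_le_trans k_ge1.
pose yp i := Num.max (y i) 0; pose yn i := Num.max (- y i) 0.
have yp0 i : 0 <= yp i by rewrite /yp le_max lexx orbT.
have yn0 i : 0 <= yn i by rewrite /yn le_max lexx orbT.
have yE i : y i = yp i - yn i.
  by rewrite /yp /yn; case: (leP (y i) 0); case: (leP (- y i) 0) => *; lra.
have ypn i : yp i * yn i = 0.
  rewrite /yp /yn; case: (leP (y i) 0); case: (leP (- y i) 0) => *;
    rewrite ?mulr0 ?mul0r //; lra.
have wE j : wgt y j = wgt yp j - wgt yn j.
  by rewrite /wgt -sumrB; apply: eq_bigr => i _; rewrite {1}yE mulrBr.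
pose A := \sum_(i in Z) yp i; pose B := \sum_(i in Z) yn i.
pose a := \sum_(i in N) y i.
(* [X] is the mean of [wgt y] over [N], whose size is [r / k]. *)
pose X := (\sum_(j in N) wgt yp j - \sum_(j in N) wgt yn j) * k / r.
have WB := wgt_sqr_bound yp0 yn0; rewrite /= -/A -/B -/X in WB.
have wN : \sum_(j in N) wgt y j = r / k * X.
  rewrite (eq_bigr _ (fun j _ => wE j)) sumrB /X; field; rewrite !gt_eqF //.
have wP : \sum_(j in P) wgt y j = r * X.
  by rewrite wgt_balanced wN; field; rewrite gt_eqF.
pose QZ := \sum_(i in Z) \sum_(j in Z) M i j * y i * y j.
have splitF : \sum_i \sum_j M i j * y i * y j =
    2 * k * a ^+ 2 + 2 * \sum_(j in P) y j * wgt y j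
    + 2 * \sum_(j in N) y j * wgt y j + QZ.
  have rowP i : i \in P -> \sum_j M i j * y i * y j = y i * a + y i * wgt y i.
    move=> iP; rewrite (sum_setC2 _ disjPN) big1 ?add0r => [|j jP]; last first.
      by rewrite MPP // !mul0r.
    rewrite /a /wgt !mulr_sumr; congr (_ + _).
      by apply: eq_bigr => j jN; rewrite MPN // mul1r.
    by apply: eq_bigr => j _; rewrite (symM i j); ring.
  have rowN i : i \in N -> \sum_j M i j * y i * y j = y i * (k * a) + y i * wgt y i.
    move=> iN; rewrite (sum_setC2 _ disjPN) [X in _ + X + _]big1 ?addr0 => [|j jN]; last first.
      by rewrite MNN // !mul0r.
    rewrite /a -baly /wgt !mulr_sumr; congr (_ + _).
      by apply: eq_bigr => j jP; rewrite symM MPN // mul1r.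
    by apply: eq_bigr => j _; rewrite (symM i j); ring.
  have swap (S : {set I}) : \sum_(i in Z) \sum_(j in S) M i j * y i * y j =
      \sum_(j in S) y j * wgt y j.
    rewrite exchange_big; apply: eq_bigr => j _; rewrite /wgt mulr_sumr.
    by apply: eq_bigr => i _; ring.
  rewrite (sum_setC2 _ disjPN) (eq_bigr _ rowP).
  rewrite [X in _ + X + _](eq_bigr _ rowN) !big_split /= -!mulr_suml baly -/a.
  rewrite (eq_bigr _ (fun i _ => sum_setC2 _ disjPN)) !big_split /= (swap P) (swap N).
  rewrite -/Z -/QZ; ring.
(* Products of equal sign contribute at least 0, those of opposite sign at least their full negative
   value, because entries lie in [[0, 1]]. *)
have QZ_ge : - (2 * A * B) <= QZ.
  have -> : - (2 * A * B) =
      \sum_(i in Z) \sum_(j in Z) - (yp i * yn j + yn i * yp j).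
    under eq_bigr do rewrite sumrN big_split /= -!mulr_sumr -/A -/B.
    by rewrite sumrN big_split /= -!mulr_suml -/A -/B; ring.
  apply: ler_sum => i _; apply: ler_sum => j _.
  have /andP[m0 m1] := M01 i j; rewrite !yE.
  have := mulr_ge0 (yp0 i) (yp0 j); have := mulr_ge0 (yn0 i) (yn0 j).
  have := mulr_ge0 (yp0 i) (yn0 j); have := mulr_ge0 (yn0 i) (yp0 j).
  move=> h1 h2 h3 h4; rewrite -subr_ge0.
  have -> : M i j * (yp i - yn i) * (yp j - yn j)
      - - (yp i * yn j + yn i * yp j) = M i j * (yp i * yp j)
      + M i j * (yn i * yn j) + (1 - M i j) * (yp i * yn j)
      + (1 - M i j) * (yn i * yp j) by ring.
  by rewrite !addr_ge0 // mulr_ge0 // subr_ge0.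
(* Cauchy-Schwarz for the absolute values [yp i + yn i], combined with [cardZ]. *)
have YZ_ge : (A + B) ^+ 2 <= r * \sum_(i in Z) y i ^+ 2.
  have -> : \sum_(i in Z) y i ^+ 2 = \sum_(i in Z) (yp i + yn i) ^+ 2.
    apply: eq_bigr => i _; rewrite yE.
    by rewrite sqrrB sqrrD ypn mul0rn subr0 addr0.
  have := sum_sqr_tangent Z (fun i => yp i + yn i) ((A + B) / r).
  rewrite big_split /= -/A -/B => T.
  have c0 : 0 <= ((A + B) / r) ^+ 2 by rewrite sqr_ge0.
  have E : (A + B) = (A + B) / r * r by rewrite divfK ?gt_eqF.
  move: ((A + B) / r) (\sum_(i in Z) _) T c0 E => c S T c0 E.
  rewrite E in T *.
  have -> : (c * r) ^+ 2 = r * (c ^+ 2 * r) by ring.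
  by rewrite ler_pM2l //; have := ler_wpM2l c0 cardZ; lra.
(* The tangent points are the means: [(r * (k * a) + r * X) / (r * k)] on [P] and
   [(r * a + r / k * X) / (r / k)] on [N]. *)
have cP := sum_sqr_tangent P (fun i => r * y i + wgt y i) (a + X / k).
have cN := sum_sqr_tangent N (fun i => r * y i + wgt y i) (k * a + X).
have sqrE (S : {set I}) : \sum_(i in S) (r * y i + wgt y i) ^+ 2 =
    r ^+ 2 * \sum_(i in S) y i ^+ 2 + 2 * r * \sum_(i in S) y i * wgt y i
    + \sum_(i in S) wgt y i ^+ 2.
  rewrite !mulr_sumr -!big_split /=; apply: eq_bigr => i _; ring.
rewrite sqrE big_split /= -mulr_sumr wP baly -/a cardP in cP.
rewrite sqrE big_split /= -mulr_sumr wN -/a cardN in cN.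
have WPE : \sum_(j in P) (wgt yp j - wgt yn j) ^+ 2 = \sum_(j in P) wgt y j ^+ 2.
  by apply: eq_bigr => j _; rewrite wE.
have WNE : \sum_(j in N) (wgt yp j - wgt yn j) ^+ 2 = \sum_(j in N) wgt y j ^+ 2.
  by apply: eq_bigr => j _; rewrite wE.
rewrite WPE WNE in WB; rewrite -(pmulr_rge0 _ r_gt0) splitF.
rewrite (sum_setC2 _ disjPN) -/Z; clear splitF WPE WNE sqrE.
move: QZ (\sum_(i in Z) _) (\sum_(i in P) y i ^+ 2) (\sum_(i in N) y i ^+ 2)
  (\sum_(i in P) wgt y i ^+ 2) (\sum_(i in N) wgt y i ^+ 2)
  (\sum_(i in P) y i * wgt y i) (\sum_(i in N) y i * wgt y i)
  QZ_ge YZ_ge cP cN WB => Q YZ YP YN WP WN CP CN QZ_ge YZ_ge cP cN WB.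
have Zp : 0 <= r * (Q + r * YZ - A ^+ 2 - B ^+ 2) by rewrite pmulr_rge0 //; lra.
have sq : 0 <= r / k * (2 * k * a + X) ^+ 2 by rewrite mulr_ge0 ?sqr_ge0 ?ltW ?divr_gt0.
have eP : 2 * (a + X / k) * (r * (k * a) + r * X) - (a + X / k) ^+ 2 * (r * k)
   = r / k * (k * a + X) ^+ 2 by field; rewrite gt_eqF.
have eN : 2 * (k * a + X) * (r * a + r / k * X) - (k * a + X) ^+ 2 * (r / k)
   = r / k * (k * a + X) ^+ 2 by field; rewrite gt_eqF.
rewrite eP in cP; rewrite eN in cN.
have sqE : r / k * (2 * k * a + X) ^+ 2 = 2 * r * k * a ^+ 2
  + 2 * (r / k * (k * a + X) ^+ 2) - r / k * X ^+ 2 by field; rewrite gt_eqF.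
rewrite sqE in sq.
lra.
Qed.

End BalancedForm.

(** * Variational bound and first-order optimality *)

(** With [1%:M] as the matrix this is the Euclidean inner product. *)
Definition mxform (R : pzRingType) n (M : 'M[R]_n) (x y : 'rV[R]_n) : R :=
  (x *m M *m y^T) 0 0.

Lemma mxformE (R : comPzRingType) n (M : 'M[R]_n) x y :
  mxform M x y = \sum_i \sum_j M i j * x 0 i * y 0 j.
Proof.
rewrite /mxform mxE exchange_big; apply: eq_bigr => j _ /=.
rewrite !mxE mulr_suml; apply: eq_bigr => i _.
by rewrite (mulrC (x 0 i)).
Qed.

Lemma mxformDl (R : comPzRingType) n (M : 'M[R]_n) x1 x2 y :
  mxform M (x1 + x2) y = mxform M x1 y + mxform M x2 y.
Proof. by rewrite /mxform !mulmxDl mxE. Qed.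

Lemma mxformDr (R : comPzRingType) n (M : 'M[R]_n) x y1 y2 :
  mxform M x (y1 + y2) = mxform M x y1 + mxform M x y2.
Proof. by rewrite /mxform linearD /= mulmxDr mxE. Qed.

Lemma mxformZl (R : comPzRingType) n (M : 'M[R]_n) a x y :
  mxform M (a *: x) y = a * mxform M x y.
Proof. by rewrite /mxform -!scalemxAl mxE. Qed.

Lemma mxformZr (R : comPzRingType) n (M : 'M[R]_n) a x y :
  mxform M x (a *: y) = a * mxform M x y.
Proof. by rewrite /mxform linearZ /= -!scalemxAr mxE. Qed.

Lemma mxformDM (R : comPzRingType) n (M N : 'M[R]_n) x y :
  mxform (M + N) x y = mxform M x y + mxform N x y.
Proof. by rewrite /mxform mulmxDr mulmxDl mxE. Qed.

Lemma mxformZM (R : comPzRingType) n a (M : 'M[R]_n) x y :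
  mxform (a *: M) x y = a * mxform M x y.
Proof. by rewrite /mxform -scalemxAr -scalemxAl mxE. Qed.

Lemma mxform_sym (R : comPzRingType) n (M : 'M[R]_n) x y :
  M^T = M -> mxform M x y = mxform M y x.
Proof.
move=> symM; rewrite /mxform -[x *m _ *m _]trmxK mxE !trmx_mul !trmxK symM.
by rewrite mulmxA.
Qed.

Lemma mxform_eigen (R : comPzRingType) n (M : 'M[R]_n) a x y :
  x *m M = a *: x -> mxform M x y = a * mxform 1%:M x y.
Proof. by rewrite /mxform => ->; rewrite mulmx1 -scalemxAl mxE. Qed.

Lemma mxform_lincomb2 (R : comPzRingType) n (M : 'M[R]_n) c1 c2 x1 x2 :
  M^T = M ->
  mxform M (c1 *: x1 + c2 *: x2) (c1 *: x1 + c2 *: x2) =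
  c1 ^+ 2 * mxform M x1 x1 + 2 * c1 * c2 * mxform M x1 x2
  + c2 ^+ 2 * mxform M x2 x2.
Proof.
move=> symM; rewrite !(mxformDl, mxformDr) !(mxformZl, mxformZr).
by rewrite (mxform_sym x2 x1 symM); ring.
Qed.

(* Choose the combination orthogonal to the eigenvector of the last eigenvalue. *)
Lemma lambda_le_pencil (R : realType) m (M : 'M[R]_m.+2) (x1 x2 : 'rV_m.+2) :
  M^T = M -> exists c1 c2, (c1 != 0) || (c2 != 0) /\
    let x := c1 *: x1 + c2 *: x2 in
    lambda m.+1 M * mxform 1%:M x x <= mxform M x x.
Proof.
move=> symM; have [szE [Q QQ QMQ]] := spectral_eigs symM.
have QQ' : Q^T *m Q = 1%:M by apply: mulmx1C.
pose w1 := (x1 *m Q^T) 0 ord_max; pose w2 := (x2 *m Q^T) 0 ord_max.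
have [c1 [c2 [cN0 cw]]] : exists c1 c2 : R,
    (c1 != 0) || (c2 != 0) /\ c1 * w1 + c2 * w2 = 0.
  have [w0|/norP[w1N w2N]] := boolP ((w1 != 0) || (w2 != 0)).
    exists w2, (- w1); rewrite oppr_eq0 orbC; split => //; ring.
  exists 1, 0; rewrite oner_eq0; split => //.
  by rewrite (eqP (negbNE w1N)) mulr0 mul0r addr0.
exists c1, c2; split => //=; set x := c1 *: x1 + c2 *: x2.
pose y := x *m Q^T.
have xE : x = y *m Q by rewrite /y -mulmxA QQ' mulmx1.
have y0 : y 0 ord_max = 0.
  by rewrite /y /x mulmxDl -!scalemxAl mxE [X in X + _]mxE [X in _ + X]mxE.
clearbody y.
have -> : mxform 1%:M x x = \sum_i y 0 i ^+ 2.
  rewrite /mxform mulmx1 xE trmx_mul mulmxA -(mulmxA y) QQ mulmx1 mxE.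
  by apply: eq_bigr => i _; rewrite mxE expr2.
have -> : mxform M x x = \sum_(i < m.+2) (eigs M)`_i * y 0 i ^+ 2.
  rewrite /mxform; have -> : x *m M *m x^T = y *m (Q *m M *m Q^T) *m y^T.
    by rewrite xE trmx_mul !mulmxA.
  rewrite QMQ mxE; apply: eq_bigr => i _.
  by rewrite mul_mx_diag !mxE; ring.
rewrite mulr_sumr; apply: ler_sum => i _.
(* The coordinate at the last index vanishes. Every other index is at most [m], and entry [m] of the
   decreasing list is [lambda m.+1 M]. *)
have [->|iN] := eqVneq i ord_max; first by rewrite y0 expr0n /= !mulr0.
rewrite ler_wpM2r ?sqr_ge0 // /lambda /=.
have srt : sorted (fun a b : R => b <= a) (eigs M).
  by apply: sort_sorted => a b; exact: le_total.
have im : (i <= m)%N.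
  by have := ltn_ord i; rewrite ltnS leq_eqVlt => /orP[/eqP E|//]; case/eqP: iN; apply/val_inj.
have tr : transitive (fun a b : R => b <= a) by move=> b a c h1 h2; apply: le_trans h1.
apply: (sorted_leq_nth tr _ 0 srt) => //; rewrite ?inE ?szE ?ltnS //.
by apply: leq_trans im _.
Qed.

(** Both vectors are rows of one orthogonal matrix, so they are orthonormal even if the two
    eigenvalues coincide. *)
Lemma bottom_eigenvectors (R : realType) m (M : 'M[R]_m.+2) : M^T = M ->
  exists u v : 'rV[R]_m.+2,
    [/\ u *m M = lambda m.+2 M *: u, v *m M = lambda m.+1 M *: v,
        mxform 1%:M u u = 1, mxform 1%:M v v = 1 & mxform 1%:M u v = 0].
Proof.
move=> symM; have [szE [Q QQ QMQ]] := spectral_eigs symM.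
have QM : Q *m M = diag_mx (\row_i (eigs M)`_i) *m Q.
  by rewrite -QMQ -mulmxA (mulmx1C QQ) mulmx1.
have rowQM i : row i Q *m M = (eigs M)`_i *: row i Q.
  by rewrite -row_mul QM row_mul row_diag_mx -scalemxAl -rowE mxE.
have rowQ i j : mxform 1%:M (row i Q) (row j Q) = (i == j)%:R.
  have := congr1 (fun A : 'M_m.+2 => A i j) QQ; rewrite [RHS]mxE => <-.
  by rewrite /mxform mulmx1 !mxE; apply: eq_bigr => k _; rewrite !mxE.
exists (row ord_max Q), (row (inord m) Q).
have neq : (ord_max == inord m :> 'I_m.+2) = false.
  by apply/eqP => /(congr1 val) /=; rewrite inordK // => /eqP; rewrite gtn_eqF.
split; rewrite ?rowQM ?rowQ ?eqxx ?neq //.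
by rewrite /lambda inordK.
Qed.

Lemma inS_segment (R : realType) n (M S : 'M[R]_n) t :
  inS M -> inS S -> 0 <= t <= 1 -> inS (M + t *: (S - M)).
Proof.
move=> [symM M01] [symS S01] /andP[t0 t1]; split.
  by rewrite linearD linearZ linearB /= symM symS.
move=> i j; rewrite !mxE; have := M01 i j; have := S01 i j.
by move=> /andP[s0 s1] /andP[m0 m1]; apply/andP; split; nra.
Qed.

(* On the plane spanned by the two bottom eigenvectors, a first-order decrease
   of the form along [v] lowers the form of [M + t (S - M)] strictly below
   [lambda m.+1 M] for small [t], because the gap at [u] absorbs the cross term. *)
Lemma minimiser_first_order (R : realType) m (M S : 'M[R]_m.+2) u v :
  simple_minimiser M -> inS S ->
  u *m M = lambda m.+2 M *: u -> v *m M = lambda m.+1 M *: v ->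
  mxform 1%:M u u = 1 -> mxform 1%:M v v = 1 -> mxform 1%:M u v = 0 ->
  0 <= mxform (S - M) v v.
Proof.
move=> [MS [gap minM]] SS uM vM uu vv uv; rewrite leNgt; apply/negP => neg.
pose E := S - M.
pose l := lambda m.+1 M; pose d := l - lambda m.+2 M.
have d0 : 0 < d by rewrite subr_gt0.
pose g := - mxform E v v; have g0 : 0 < g by rewrite oppr_gt0.
(* Completing the square in [c2] leaves [d - t * K] as the coefficient of [c1 ^+ 2]. The choice of
   [t] gives [t <= 1] and [t * K < d], so the two resulting squares force [c1] and [c2] to
   vanish. *)
pose e := mxform E u v; pose K := mxform E u u + e ^+ 2 / g.
pose t := d / (2 * (d + `|K|)).
have dK : 0 < d + `|K| by rewrite ltr_pwDl.
have t0 : 0 < t by rewrite divr_gt0 // mulr_gt0.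
have t1 : t <= 1.
  by rewrite ler_pdivrMr ?mulr_gt0 // mul1r; have := normr_ge0 K; lra.
have tK : t * K < d.
  rewrite /t mulrAC ltr_pdivrMr ?mulr_gt0 // -subr_gt0.
  have -> : d * (2 * (d + `|K|)) - d * K = d * (2 * d + `|K| + (`|K| - K)) by ring.
  rewrite mulr_gt0 //; have := ler_norm K; have := normr_ge0 K; lra.
clearbody t.
have MtS : inS (M + t *: E) by apply: inS_segment => //; rewrite ltW.
have symM := MS.1; have symMt := MtS.1.
have symE : E^T = E by rewrite linearB /= symM SS.1.
have [c1 [c2 [cN0 /=]]] := lambda_le_pencil u v symMt.
rewrite (mxform_lincomb2 _ _ _ _ (trmx1 _ _)) uu uv vv.
rewrite mxformDM mxformZM !mxform_lincomb2 //.
rewrite (mxform_eigen u uM) (mxform_eigen v uM) (mxform_eigen v vM) uu uv vv.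
have := minM _ MtS; rewrite /= -/l => lle.
rewrite -/e -[mxform E v v]opprK -/g => H.
have c0 : 0 <= c1 ^+ 2 * 1 + 2 * c1 * c2 * 0 + c2 ^+ 2 * 1.
  by rewrite mulr0 addr0 !mulr1 addr_ge0 ?sqr_ge0.
have {}H := le_trans (ler_wpM2r c0 lle) H.
have EK : mxform E u u = K - e ^+ 2 / g by rewrite /K addrK.
have lE : lambda m.+2 M = l - d by rewrite /d opprB addrC subrK.
rewrite lE EK in H.
have : c1 ^+ 2 * (d - t * K) + t / g * (e * c1 - g * c2) ^+ 2 <= 0.
  rewrite -subr_ge0; move: H; rewrite -subr_ge0; congr (_ <= _).
  by field; rewrite gt_eqF.
have p1 : 0 <= c1 ^+ 2 * (d - t * K) by rewrite mulr_ge0 ?sqr_ge0 ?subr_ge0 ?ltW.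
have p2 : 0 <= t / g * (e * c1 - g * c2) ^+ 2.
  by apply: mulr_ge0; [apply: divr_ge0; apply: ltW | apply: sqr_ge0].
move=> le0; have z1 : c1 ^+ 2 * (d - t * K) = 0 by lra.
have z2 : t / g * (e * c1 - g * c2) ^+ 2 = 0 by lra.
have c10 : c1 = 0.
  move/eqP: z1; rewrite mulf_eq0 [_ - _ == 0]gt_eqF ?subr_gt0 // orbF.
  by rewrite expf_eq0 /= => /eqP.
move/eqP: z2; rewrite mulf_eq0 [t / g == 0]gt_eqF ?divr_gt0 // orFb expf_eq0 c10 mulr0 sub0r.
rewrite oppr_eq0 mulf_eq0 [g == 0]gt_eqF //= => /eqP c20.
by rewrite c10 c20 eqxx in cN0.
Qed.

(** * Structure of a simple minimiser *)

Lemma sym_mxE (R : Type) n (M : 'M[R]_n) :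
  M^T = M -> forall i j, M i j = M j i.
Proof. by move=> symM i j; rewrite -[in RHS]symM mxE. Qed.

(** Compare [M] with the matrix [S] that has the prescribed values. Each term of the form of [S - M]
    at [v] is at most 0, while first-order optimality makes the sum non-negative, so every term is
    0. *)
Lemma minimiser_sign_pattern (R : realType) m (M : 'M[R]_m.+2) u v :
  simple_minimiser M ->
  u *m M = lambda m.+2 M *: u -> v *m M = lambda m.+1 M *: v ->
  mxform 1%:M u u = 1 -> mxform 1%:M v v = 1 -> mxform 1%:M u v = 0 ->
  forall i j, (0 < v 0 i * v 0 j -> M i j = 0) /\
              (v 0 i * v 0 j < 0 -> M i j = 1).
Proof.
move=> minM uM vM uu vv uv; have [symM M01] := minM.1.
pose S : 'M[R]_m.+2 := \matrix_(i, j)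
  if 0 < v 0 i * v 0 j then 0 else if v 0 i * v 0 j < 0 then 1 else M i j.
have SS : inS S.
  split=> [|i j].
    by apply/matrixP => i j; rewrite !mxE mulrC sym_mxE.
  by rewrite mxE; case: ifP => _; [|case: ifP => _]; rewrite ?lexx ?ler01.
have := minimiser_first_order minM SS uM vM uu vv uv.
rewrite mxformE.
have term_le0 i j : (S - M) i j * v 0 i * v 0 j <= 0.
  rewrite !mxE -mulrA; have /andP[m0 m1] := M01 i j.
  case: ltP => [p|np]; first by rewrite sub0r mulNr oppr_le0 mulr_ge0 // ltW.
  case: ifP => [n|_]; last by rewrite subrr mul0r.
  by rewrite mulr_ge0_le0 ?subr_ge0.
move=> sum_ge0.
have row_le0 i : \sum_j (S - M) i j * v 0 i * v 0 j <= 0 by apply: sumr_le0.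
have row0 i : \sum_j (S - M) i j * v 0 i * v 0 j = 0.
  apply/eqP; rewrite -oppr_eq0; move: i (erefl true).
  have /psumr_eq0P : forall i, true -> 0 <= - \sum_j (S - M) i j * v 0 i * v 0 j.
    by move=> i _; rewrite oppr_ge0.
  move=> H i _; apply/eqP; apply: H => //; apply: le_anti.
  by rewrite sumrN oppr_le0 oppr_ge0 sum_ge0 sumr_le0.
have term0 i j : (S - M) i j * v 0 i * v 0 j = 0.
  apply/eqP; rewrite -oppr_eq0; move: j (erefl true).
  have /psumr_eq0P : forall j, true -> 0 <= - ((S - M) i j * v 0 i * v 0 j).
    by move=> j _; rewrite oppr_ge0.
  by move=> H j _; apply/eqP; apply: H => //; rewrite sumrN row0 oppr0.
move=> i j; have := term0 i j; rewrite !mxE -mulrA => /eqP.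
rewrite mulf_eq0 subr_eq0 => H; split => [p|n].
  by move: H; rewrite p (gt_eqF p) orbF => /eqP.
by move: H; rewrite (lt_gtF n) n (lt_eqF n) orbF => /eqP.
Qed.

(** The sign of the coordinate sum of [v] gives [B <= A], that is [1 <= k], the normalisation
    required by [balanced_form_ge0]. *)
Lemma simple_minimiser_lambda_of_sum_ge0 (R : realType) m (M : 'M[R]_m.+2) u v :
  simple_minimiser M ->
  u *m M = lambda m.+2 M *: u -> v *m M = lambda m.+1 M *: v ->
  mxform 1%:M u u = 1 -> mxform 1%:M v v = 1 -> mxform 1%:M u v = 0 ->
  0 <= \sum_i v 0 i ->
  - (m.+2%:R / 3) < lambda m.+1 M.
Proof.
move=> minM uM vM uu vv uv sum_v; have [symM M01] := minM.1.
have sgn := minimiser_sign_pattern minM uM vM uu vv uv.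
rewrite ltNge; apply/negP => lle.
pose r := - lambda m.+1 M; have lE : lambda m.+1 M = - r by rewrite opprK.
have nr : m.+2%:R <= 3 * r by rewrite /r; lra.
have r0 : 0 < r by have : 0 < m.+2%:R :> R := ltr0Sn _ _; lra.
have dot (x y : 'rV[R]_m.+2) : mxform 1%:M x y = \sum_i x 0 i * y 0 i.
  by rewrite /mxform mulmx1 mxE; apply: eq_bigr => i _; rewrite mxE.
pose P := [set i | 0 < v 0 i]; pose N := [set i | v 0 i < 0].
have disjPN : [disjoint P & N].
  rewrite -setI_eq0; apply/eqP/setP => i; rewrite !inE.
  by case: ltgtP.
have Zv i : i \in ~: (P :|: N) -> v 0 i = 0.
  by rewrite !inE; case: ltgtP.
have split_v (F : 'I_m.+2 -> R) : \sum_i F i * v 0 i =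
    \sum_(i in P) F i * v 0 i + \sum_(i in N) F i * v 0 i.
  rewrite (sum_setC2 _ disjPN) [X in _ + X]big1 ?addr0 // => i /Zv ->.
  by rewrite mulr0.
have eig i : \sum_(j in P) M i j * v 0 j + \sum_(j in N) M i j * v 0 j = - r * v 0 i.
  rewrite -split_v -lE; have := congr1 (fun x : 'rV[R]_m.+2 => x 0 i) vM.
  rewrite [RHS]mxE => <-; rewrite mxE; apply: eq_bigr => j _.
  by rewrite sym_mxE // mulrC.
have MPP : {in P &, forall i j, M i j = 0}.
  by move=> i j; rewrite !inE => pi pj; apply: (sgn i j).1; rewrite mulr_gt0.
have MNN : {in N &, forall i j, M i j = 0}.
  by move=> i j; rewrite !inE => pi pj; apply: (sgn i j).1; rewrite nmulr_rgt0.
have MPN : {in P & N, forall i j, M i j = 1}.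
  by move=> i j; rewrite !inE => pi pj; apply: (sgn i j).2; rewrite pmulr_rlt0.
pose A := \sum_(i in P) v 0 i; pose B := - \sum_(i in N) v 0 i.
have vP i : i \in P -> v 0 i = B / r.
  move=> iP; have := eig i; rewrite big1 ?add0r => [|j jP]; last by rewrite MPP ?mul0r.
  rewrite (eq_bigr (fun j => v 0 j)) => [E|j jN]; last by rewrite MPN ?mul1r.
  by rewrite /B E; field; rewrite gt_eqF.
have vN i : i \in N -> v 0 i = - (A / r).
  move=> iN; have := eig i; rewrite addrC big1 ?add0r => [|j jP]; last by rewrite MNN ?mul0r.
  rewrite (eq_bigr (fun j => v 0 j)) => [E|j jP].
    by rewrite /A E; field; rewrite gt_eqF.
  by rewrite sym_mxE // MPN ?mul1r.
have A_ge0 : 0 <= A by apply: sumr_ge0 => i; rewrite inE => /ltW.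
have B_ge0 : 0 <= B.
  by rewrite oppr_ge0; apply: sumr_le0 => i; rewrite inE => /ltW.
have AE : A = #|P|%:R * (B / r).
  by rewrite /A (eq_bigr _ vP) sumr_const mulr_natl.
have BE : B = #|N|%:R * (A / r).
  by rewrite /B (eq_bigr _ vN) sumr_const mulr_natl mulNrn opprK.
have AB0 : A != 0.
  apply/eqP => A0; move: BE; rewrite A0 mul0r mulr0 => B0.
  have v0 i : v 0 i = 0.
    have [/vP->|iP] := boolP (i \in P); first by rewrite B0 mul0r.
    have [/vN->|iN] := boolP (i \in N); first by rewrite A0 mul0r oppr0.
    by apply: Zv; rewrite !inE in iP iN *; rewrite negb_or iP.
  move: vv; rewrite dot big1 => [/esym/eqP|i _]; first by rewrite oner_eq0.
  by rewrite v0 mul0r.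
have A_gt0 : 0 < A by rewrite lt_def AB0.
have B_gt0 : 0 < B.
  rewrite lt_def B_ge0 andbT; apply/eqP => B0.
  by move/eqP: AE; rewrite B0 mul0r mulr0 (negPf AB0).
have BA : B <= A.
  rewrite -subr_ge0 opprK /A; move: sum_v.
  rewrite (sum_setC2 _ disjPN) [X in _ + X]big1 ?addr0 // => i /Zv //.
pose k := A / B.
have k0 : 0 < k by rewrite divr_gt0.
have k1 : 1 <= k by rewrite ler_pdivlMr ?mul1r.
have cardP : #|P|%:R = r * k.
  apply: (mulIf (x := B / r)); first by rewrite gt_eqF ?divr_gt0.
  by rewrite -AE /k; field; rewrite !gt_eqF.
have cardN : #|N|%:R = r / k.
  apply: (mulIf (x := A / r)); first by rewrite gt_eqF ?divr_gt0.
  by rewrite -BE /k; field; rewrite !gt_eqF.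
pose z : R := #|~: (P :|: N)|%:R.
(* By AM-GM [r * k + r / k] is at least [2 * r], so at most [m.+2 - 2 * r], hence at most [r],
   vertices remain for the zero set. *)
have cardZ : z <= r.
  have : (#|P| + #|N| + #|~: (P :|: N)|)%:R = m.+2%:R :> R.
    rewrite -[in RHS](card_ord m.+2) -[in RHS]sum1_card (sum_setC2 _ disjPN).
    by rewrite !sum1_card.
  rewrite !natrD cardP cardN -/z.
  have : 0 <= r / k * (k - 1) ^+ 2 by rewrite mulr_ge0 ?sqr_ge0 // ltW ?divr_gt0.
  have -> : r / k * (k - 1) ^+ 2 = r * k + r / k - 2 * r by field; rewrite gt_eqF.
  by move: z nr => *; lra.
have kE (x y : R) : B / r * x = A / r * y -> x = k * y.
  move=> E; rewrite /k; apply: (mulfI (x := B / r)).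
    by rewrite mulf_neq0 ?invr_eq0 ?gt_eqF.
  by rewrite E; field; rewrite !gt_eqF.
(* Where [v] vanishes the eigenvalue equation has right-hand side 0; inserting the values [B / r]
   and [- (A / r)] of [v] gives the balance. Orthogonality of [u] and [v] gives [balu] in the same
   way. *)
have balM : {in ~: (P :|: N), forall i,
    \sum_(j in P) M i j = k * \sum_(j in N) M i j}.
  move=> i iZ; apply: kE; have := eig i; rewrite (Zv i iZ) mulr0.
  rewrite (eq_bigr (fun j => B / r * M i j)) => [|j /vP ->]; last by rewrite mulrC.
  rewrite [X in _ + X](eq_bigr (fun j => - (A / r * M i j))) => [|j /vN ->]; last first.
    by rewrite mulrN mulrC.
  by rewrite sumrN -!mulr_sumr => /eqP; rewrite subr_eq0 => /eqP.
have balu : \sum_(i in P) u 0 i = k * \sum_(i in N) u 0 i.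
  apply: kE; move: uv; rewrite dot split_v.
  rewrite (eq_bigr (fun j => B / r * u 0 j)) => [|j /vP ->]; last by rewrite mulrC.
  rewrite [X in _ + X](eq_bigr (fun j => - (A / r * u 0 j))) => [|j /vN ->]; last first.
    by rewrite mulrN mulrC.
  by rewrite sumrN -!mulr_sumr => /eqP; rewrite subr_eq0 => /eqP.
have symM' := sym_mxE symM.
(* At the unit vector [u] the form equals [lambda m.+2 M + r]; its non-negativity contradicts the
   gap below [lambda m.+1 M]. *)
have := balanced_form_ge0 symM' M01 disjPN MPP MNN MPN r0 k1 cardP cardN cardZ balM balu.
rewrite -mxformE (mxform_eigen u uM) uu.
have -> : \sum_i u 0 i ^+ 2 = 1 by rewrite -uu dot; apply: eq_bigr => i _; rewrite expr2.
apply/negP; rewrite -ltNge !mulr1.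
by have [_ [gap _]] := minM; move: gap; rewrite lE /= => gap; lra.
Qed.

Lemma simple_minimiser_lambda (R : realType) m (M : 'M[R]_m.+2) :
  simple_minimiser M -> - (m.+2%:R / 3) < lambda m.+1 M.
Proof.
move=> minM; have [u [v [uM vM uu vv uv]]] := bottom_eigenvectors minM.1.1.
have [sv|/ltW sv] := leP 0 (\sum_i v 0 i).
  exact: (@simple_minimiser_lambda_of_sum_ge0 _ _ _ u v).
apply: (@simple_minimiser_lambda_of_sum_ge0 _ _ _ u (- v)) => //.
- by rewrite mulNmx vM scalerN.
- by rewrite -scaleN1r mxformZl mxformZr vv !mulN1r opprK.
- by rewrite -scaleN1r mxformZr uv mulr0.
- by under eq_bigr do rewrite mxE; rewrite sumrN oppr_ge0.
Qed.

(** * Complete tripartite vertex multiplications *)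

Definition tripartite_sizes (a b : nat) : seq nat :=
  [:: a; 0; 0; 0; a; 0; 0; 0; b; 0; 0]%N.

(** An empty block leaves the partial sum unchanged, so the least index with a strict inequality
    never falls on it. *)
Lemma block_tripartite a b i : (i < a + a + b)%N ->
  block (tripartite_sizes a b) i =
  (if i < a then 0 else if i < a + a then 4 else 8)%N.
Proof.
move=> ib; rewrite /block /= !big_ord_recr !big_ord0 /=.
rewrite !addn0 !add0n.
case: ltnP => // h1; case: ltnP => // h2.
by rewrite ib.
Qed.

Lemma tripartite_entry (R : realType) a b n (i j : 'I_n) : n = (a + a + b)%N ->
  vmult (Tmx R) (tripartite_sizes a b) n i j =
  (block (tripartite_sizes a b) i != block (tripartite_sizes a b) j)%:R.
Proof.
move=> nE.
rewrite mxE !block_tripartite -?nE ?ltn_ord // mxE.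
by case: (i < a)%N (i < a + a)%N (j < a)%N (j < a + a)%N => -[] [] [];
  rewrite !inordK.
Qed.

Lemma sum_block_tripartite (R : pzSemiRingType) a b n (F : nat -> R) :
  n = (a + a + b)%N ->
  \sum_(i < n) F (block (tripartite_sizes a b) i) =
  a%:R * F 0%N + a%:R * F 4 + b%:R * F 8.
Proof.
move=> ->.
rewrite -(big_mkord xpredT (fun i => F (block (tripartite_sizes a b) i))).
rewrite (@big_cat_nat _ _ _ (a + a)) ?leq_addr //=.
rewrite (@big_cat_nat _ _ _ a) ?leq_addr //=.
rewrite !big_nat (eq_bigr (fun=> F 0%N)); last first.
  by move=> i /andP[_ ia]; rewrite block_tripartite ?ia //; lia.
rewrite [X in _ + X + _](eq_bigr (fun=> F 4)); last first.
  move=> i /andP[ia iaa]; rewrite block_tripartite; last by lia.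
  by rewrite ltnNge ia iaa.
rewrite [X in _ + X](eq_bigr (fun=> F 8)); last first.
  move=> i /andP[ia iaa]; rewrite block_tripartite // !ltnNge ia /=.
  by rewrite (leq_trans _ ia) ?leq_addr.
by rewrite -!big_nat !sumr_const_nat !addKn subn0 !mulr_natl.
Qed.

(** On a plane of block-constant vectors with coordinate sum 0 the form is at most [- a%:R] times
    the squared norm; [lambda_le_pencil] finds a vector of that plane where it is at least
    [lambda m.+1] times the squared norm. *)
Lemma lambda_tripartite (R : realType) m a b :
  m.+2 = (a + a + b)%N -> (a <= b)%N ->
  lambda m.+1 (vmult (Tmx R) (tripartite_sizes a b) m.+2) <= - a%:R.
Proof.
move=> nE ab; set M := vmult _ _ _.
pose bl := block (tripartite_sizes a b).
have ME i j : M i j = (bl i != bl j)%:R by rewrite /M tripartite_entry.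
have symM : M^T = M by apply/matrixP => i j; rewrite mxE !ME eq_sym.
have form1 (x : 'rV[R]_m.+2) : mxform 1%:M x x = \sum_i x 0 i ^+ 2.
  by rewrite /mxform mulmx1 mxE; apply: eq_bigr => i _; rewrite mxE expr2.
(* For [a = 0] the block-constant vectors used below vanish; the matrix is then 0 and two basis
   vectors serve instead. *)
have [a0|a_gt0] := posnP a.
  have M0 : M = 0.
    apply/matrixP => i j; rewrite ME /bl !block_tripartite -?nE ?ltn_ord //.
    by rewrite a0 !mxE.
  pose x1 : 'rV[R]_m.+2 := delta_mx 0 0.
  pose x2 : 'rV[R]_m.+2 := delta_mx 0 ord_max.
  have [c1 [c2 [cN0 /=]]] := lambda_le_pencil x1 x2 symM.
  set x := (_ + _); rewrite {2}M0.
  have -> : mxform 0 x x = 0 :> R by rewrite /mxform mulmx0 mul0mx mxE.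
  rewrite a0 oppr0 form1 => le0; rewrite leNgt; apply/negP => l0.
  move: le0; rewrite pmulr_rle0 // => le0.
  have x0 i : x 0 i = 0.
    apply/eqP; rewrite -sqrf_eq0.
    have /psumr_eq0P H : forall i, true -> 0 <= x 0 i ^+ 2 by move=> *; apply: sqr_ge0.
    by rewrite H //; apply: le_anti; rewrite le0 sumr_ge0 // => *; apply: sqr_ge0.
  have := x0 0; have := x0 ord_max.
  rewrite !mxE !eqxx /= !mulr0 !mulr1 addr0 add0r => c20 c10.
  by rewrite c10 c20 eqxx in cN0.
have b_gt0 : (0 < b)%N by apply: leq_trans ab.
(* Two independent block profiles, [(1, -1, 0)] and [(b, b, -2a)], orthogonal to the block sizes
   [(a, a, b)]. *)
pose s1 j : R := if j is 0%N then 1 else if j is 4 then -1 else 0.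
pose s2 j : R := if j is 8 then - (2 * a%:R) else b%:R.
have [c1 [c2 [cN0 /=]]] :=
  lambda_le_pencil (\row_i s1 (bl i)) (\row_i s2 (bl i)) symM.
set x := (_ + _); pose s j := c1 * s1 j + c2 * s2 j.
have xE i : x 0 i = s (bl i) by rewrite !mxE.
rewrite form1 mxformE; under eq_bigr do rewrite xE.
under [X in _ <= X -> _]eq_bigr do under eq_bigr do rewrite !xE ME.
rewrite (sum_block_tripartite (fun j => s j ^+ 2) nE).
under eq_bigr => i _ do
  rewrite (sum_block_tripartite (fun j => (bl i != j)%:R * s (bl i) * s j) nE).
rewrite (sum_block_tripartite (fun k => a%:R * ((k != 0%N)%:R * s k * s 0%N) +
  a%:R * ((k != 4)%:R * s k * s 4) + b%:R * ((k != 8)%:R * s k * s 8)) nE) /=.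
have bal : a%:R * s 0%N + a%:R * s 4 + b%:R * s 8 = 0 by rewrite /s /=; ring.
have A0 : 0 < a%:R :> R by rewrite ltr0n.
have B0 : 0 < b%:R :> R by rewrite ltr0n.
have AB : a%:R <= b%:R :> R by rewrite ler_nat.
have norm_gt0 : 0 < a%:R * s 0%N ^+ 2 + a%:R * s 4 ^+ 2 + b%:R * s 8 ^+ 2.
  have sq j : 0 <= a%:R * s j ^+ 2 by rewrite mulr_ge0 ?sqr_ge0 ?ltW.
  have sq' j : 0 <= b%:R * s j ^+ 2 by rewrite mulr_ge0 ?sqr_ge0 ?ltW.
  rewrite lt_def !addr_ge0 // andbT; apply: contraL cN0.
  rewrite !paddr_eq0 ?addr_ge0 // !mulf_eq0 (gt_eqF A0) (gt_eqF B0) /= !orbb.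
  move=> /andP[/andP[/eqP z0 /eqP z4] _].
  have c20 : c2 = 0.
    by apply: (mulIf (lt0r_neq0 B0)); rewrite mul0r; move: z0 z4; rewrite /s /=; lra.
  by move: z0; rewrite /s /= c20 mul0r addr0 mulr1 => ->; rewrite eqxx.
move: (s 0%N) (s 4) (s 8) bal norm_gt0 => s0 s4 s8 bal norm_gt0 le_form.
rewrite -(ler_pM2r norm_gt0); apply: le_trans le_form _; rewrite -subr_ge0.
(* The form is the squared coordinate sum minus the squared block sums, so this expression is
   exactly the slack of the goal. *)
have : 0 <= b%:R * (b%:R - a%:R) * s8 ^+ 2
    - (a%:R * s0 + a%:R * s4 + b%:R * s8) ^+ 2.
  by rewrite bal expr0n subr0 mulr_ge0 ?sqr_ge0 // mulr_ge0 ?subr_ge0 // ltW.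
by congr (_ <= _); ring.
Qed.

(** * Choice of the block sizes and the rounding error *)

Theorem theorem4p6 (R : realType) (n : nat) (hn : (2 <= n)%N) :
  (exists M : 'M[R]_n, simple_minimiser M) ->
  exists xs : seq nat,
    size xs = 11%N /\ (\sum_(x <- xs) x)%N = n /\
    forall S : 'M[R]_n, inS S ->
      lambda n.-1 (vmult (Tmx R) xs n) - 2 * Num.sqrt (n%:R) <= lambda n.-1 S.
Proof.
case: n hn => [|[|m]] // _ [M minM].
pose a := (m.+2 %/ 3)%N; pose b := (m.+2 - (a + a))%N.
have a3 : (m.+2 <= 3 * a + 2)%N by rewrite /a; lia.
have ab : (a <= b)%N by rewrite /b /a; lia.
have nE : m.+2 = (a + a + b)%N by rewrite /b /a; lia.
exists (tripartite_sizes a b); split=> //; split.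
  by rewrite unlock /=; lia.
move=> S SS; apply: le_trans (minM.2.2 _ SS) => /=.
apply: le_trans (ltW (simple_minimiser_lambda minM)).
have := lambda_tripartite R nE ab; set l := lambda _ _ => l_le.
have sqrt1 : 1 <= Num.sqrt m.+2%:R :> R.
  by rewrite -[leLHS]sqrtr1 ler_wsqrtr // ler1n.
(* Rounding [m.+2 / 3] down to [a] costs at most 2/3, less than twice the square root, which is at
   least 2. *)
have : m.+2%:R <= 3 * a%:R + 2 :> R by rewrite -natrM -natrD ler_nat.
move: sqrt1; move: (Num.sqrt _) => q sqrt1 n_le; lra.
Qed.
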